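(* For any extended logic programs $P_1$ and $P_2$, with $\mathcal{A}$ the set of atoms occurring in $P_1\cup P_2$, the update answer sets of $(P_1,P_2)$ (the sets $S'\cap Lit_{\mathcal{A}}$ with $S'$ an answer set of $P_1\oplus_1P_2$) are exactly the answer sets of $P_1\oplus_3P_2$.
   Context: Formulas use $\wedge,\vee,\rightarrow,\bot$ and strong negation $\sim$; $\lnot F$ is $F\rightarrow\bot$, $\top$ is $\bot\rightarrow\bot$. A literal is an atom $a$ or $\sim a$; $\sim L$ is the complement of $L$ ($\sim\sim a=a$); $Lit_{\mathcal{A}}$ is the set of literals over $\mathcal{A}$. An extended logic program (ELP) is a finite set of rules $r$: $L\leftarrow B_1,\dots,B_m,\lnot B_{m+1},\dots,\lnot B_n$ ($L,B_i$ literals, $\top$ or $\bot$); $H(r)=L$, $B(r)$ the body conjunction ($\top$ if empty); constraint if $H(r)=\bot$. $\mathrm{N}_2$ is intuitionistic logic plus Nelson's axioms ($\sim(\alpha\rightarrow\beta)\leftrightarrow\alpha\wedge\sim\beta$, $\sim(\alpha\wedge\beta)\leftrightarrow\sim\alpha\vee\sim\beta$, $\sim(\alpha\vee\beta)\leftrightarrow\sim\alpha\wedge\sim\beta$, $\alpha\leftrightarrow\sim\sim\alpha$, $\sim\lnot\alpha\leftrightarrow\alpha$, $\sim a\rightarrow\lnot a$) and $\alpha\vee(\alpha\rightarrow\beta)\vee\lnot\beta$. For a finite set of formulas $T$ over atoms $\mathcal{B}$, a consistent $M\subseteq Lit_{\mathcal{B}}$ is an answer set iff $T\cup\{\lnot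 l: l\in Lit_{\mathcal{B}}\setminus M\}\cup\{\lnot\lnot l:l\in M\}$ is $\mathrm{N}_2$-consistent and $\mathrm{N}_2$-derives each element of $M$. Operator $\oplus_1$: add fresh atoms $rej(r)$ for each rule $r$ (rules of $P_1$ and $P_2$ named distinctly) and $A_1,A_2$ for $A\in\mathcal{A}$; $L_i$ replaces the atom $A$ of $L$ by $A_i$. $P_1\oplus_1P_2$ consists of: (i) all constraints of $P_1\cup P_2$; (ii) for each non-constraint $r\in P_1$ with $H(r)=L$: $L_1\leftarrow B(r),\lnot rej(r)$ and $rej(r)\leftarrow B(r),\sim L_2$; (iii) for each non-constraint $r\in P_2$ with $H(r)=L$: $L_2\leftarrow B(r)$; (iv) for each literal $L$ occurring in $P_1\cup P_2$: $L_1\leftarrow L_2$ and $L\leftarrow L_1$. Operator $\oplus_3$: for a program $P$ and literal $L$ let $K_L=\{B(r): r\in P, H(r)=L\}$ and $sup(L,P)=\bot$ if no rule of $P$ has head $L$, $sup(L,P)=\top$ if some rule of $P$ with head $L$ has body $\top$, and $sup(L,P)=\bigvee K_L$ otherwise. $P_1\oplus_3P_2$ consists of (i) all constraints of $P_1\cup P_2$; (ii) for each non-constraint $r\in P_1$ with $H(r)=L$: $L\leftarrow B(r),\lnot sup(\sim L,P_2)$; (iii) all rules of $P_2$. *)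

(* Defs.v *)
From HB Require Import structures.
From mathcomp Require Import all_boot.
From mathcomp Require Import classical_sets.

Set Implicit Arguments.
Unset Strict Implicit.
Unset Printing Implicit Defensive.

Local Open Scope classical_set_scope.

Inductive formula (T : Type) : Type :=
| Atom of T
| Bot
| And of formula T & formula T
| Or  of formula T & formula T
| Imp of formula T & formula T
| SNeg of formula T.

Arguments Bot {T}.

Definition Not (T : Type) (F : formula T) : formula T := Imp F Bot.
Definition Top (T : Type) : formula T := Imp Bot Bot.
Definition Iff (T : Type) (F G : formula T) : formula T :=
  And (Imp F G) (Imp G F).

Arguments Top {T}.

Fixpoint formula_code (T : Type) (F : formula T) : GenTree.tree T :=
  match F with
  | Atom a => GenTree.Leaf a
  | Bot => GenTree.Node 0 [::]
  | And F G => GenTree.Node 1 [:: formula_code F; formula_code G]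
  | Or F G => GenTree.Node 2 [:: formula_code F; formula_code G]
  | Imp F G => GenTree.Node 3 [:: formula_code F; formula_code G]
  | SNeg F => GenTree.Node 4 [:: formula_code F]
  end.

Fixpoint formula_decode (T : Type) (t : GenTree.tree T) : option (formula T) :=
  match t with
  | GenTree.Leaf a => Some (Atom a)
  | GenTree.Node 0 [::] => Some Bot
  | GenTree.Node 1 [:: t; u] =>
      if (formula_decode t, formula_decode u) is (Some F, Some G)
      then Some (And F G) else None
  | GenTree.Node 2 [:: t; u] =>
      if (formula_decode t, formula_decode u) is (Some F, Some G)
      then Some (Or F G) else None
  | GenTree.Node 3 [:: t; u] =>
      if (formula_decode t, formula_decode u) is (Some F, Some G)
      then Some (Imp F G) else None
  | GenTree.Node 4 [:: t] =>
      if formula_decode t is Some F then Some (SNeg F) else None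
  | _ => None
  end.

Lemma formula_codeK (T : Type) :
  pcancel (@formula_code T) (@formula_decode T).
Proof. by elim=> //= [F -> G ->|F -> G ->|F -> G ->|F ->]. Qed.

HB.instance Definition _ (T : eqType) :=
  Equality.copy (formula T) (pcan_type (@formula_codeK T)).

(* A one-element conjunction (disjunction) is its element, so that a body that
   consists of [Top] alone is the formula [Top], as is the empty body. *)
Fixpoint conj (T : Type) (s : seq (formula T)) : formula T :=
  match s with
  | [::] => Top
  | [:: F] => F
  | F :: s' => And F (conj s')
  end.

Fixpoint disj (T : Type) (s : seq (formula T)) : formula T :=
  match s with
  | [::] => Bot
  | [:: F] => F
  | F :: s' => Or F (disj s')
  end.

Inductive N2_axiom (T : Type) : formula T -> Prop :=
| ax_K F G : N2_axiom (Imp F (Imp G F))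
| ax_S F G H :
    N2_axiom (Imp (Imp F (Imp G H)) (Imp (Imp F G) (Imp F H)))
| ax_andI F G : N2_axiom (Imp F (Imp G (And F G)))
| ax_andEl F G : N2_axiom (Imp (And F G) F)
| ax_andEr F G : N2_axiom (Imp (And F G) G)
| ax_orIl F G : N2_axiom (Imp F (Or F G))
| ax_orIr F G : N2_axiom (Imp G (Or F G))
| ax_orE F G H :
    N2_axiom (Imp (Imp F H) (Imp (Imp G H) (Imp (Or F G) H)))
| ax_botE F : N2_axiom (Imp Bot F)
| ax_snegImp F G : N2_axiom (Iff (SNeg (Imp F G)) (And F (SNeg G)))
| ax_snegAnd F G : N2_axiom (Iff (SNeg (And F G)) (Or (SNeg F) (SNeg G)))
| ax_snegOr F G : N2_axiom (Iff (SNeg (Or F G)) (And (SNeg F) (SNeg G)))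
| ax_snegSneg F : N2_axiom (Iff F (SNeg (SNeg F)))
| ax_snegNot F : N2_axiom (Iff (SNeg (Not F)) F)
| ax_snegAtom (a : T) : N2_axiom (Imp (SNeg (Atom a)) (Not (Atom a)))
| ax_N2 F G : N2_axiom (Or F (Or (Imp F G) (Not G))).

Inductive N2 (T : Type) (Gamma : set (formula T)) : formula T -> Prop :=
| N2_hyp F : Gamma F -> N2 Gamma F
| N2_ax F : N2_axiom F -> N2 Gamma F
| N2_mp F G : N2 Gamma (Imp F G) -> N2 Gamma F -> N2 Gamma G.

Definition N2_consistent (T : Type) (Gamma : set (formula T)) : Prop :=
  ~ N2 Gamma Bot.

Inductive literal (T : Type) : Type := Pos of T | Neg of T.

Definition literal_code (T : Type) (l : literal T) : T + T :=
  match l with Pos a => inl a | Neg a => inr a end.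

Definition literal_decode (T : Type) (s : T + T) : literal T :=
  match s with inl a => Pos a | inr a => Neg a end.

Lemma literal_codeK (T : Type) :
  cancel (@literal_code T) (@literal_decode T).
Proof. by case. Qed.

HB.instance Definition _ (T : eqType) :=
  Equality.copy (literal T) (can_type (@literal_codeK T)).

Definition atom_of (T : Type) (l : literal T) : T :=
  match l with Pos a => a | Neg a => a end.

Definition compl (T : Type) (l : literal T) : literal T :=
  match l with Pos a => Neg a | Neg a => Pos a end.

Definition lit_map (T U : Type) (f : T -> U) (l : literal T) : literal U :=
  match l with Pos a => Pos (f a) | Neg a => Neg (f a) end.

Definition lit_formula (T : Type) (l : literal T) : formula T :=
  match l with Pos a => Atom a | Neg a => SNeg (Atom a) end.

Definition Lit (T : eqType) (B : seq T) : set (literal T) :=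
  [set l | atom_of l \in B].

Definition consistent_literals (T : Type) (M : set (literal T)) : Prop :=
  forall l, ~ (M l /\ M (compl l)).

Definition completion (T : eqType) (B : seq T) (Th : seq (formula T))
    (M : set (literal T)) : set (formula T) :=
  [set` Th]
  `|` [set Not (lit_formula l) | l in Lit B `\` M]
  `|` [set Not (Not (lit_formula l)) | l in M].

Definition answer_sets (T : eqType) (B : seq T) (Th : seq (formula T)) :
    set (set (literal T)) :=
  [set M | [/\ M `<=` Lit B, consistent_literals M,
               N2_consistent (completion B Th M) &
               forall l, M l -> N2 (completion B Th M) (lit_formula l)]].

Inductive extlit (T : Type) : Type := ELit of literal T | ETop | EBot.

Arguments ETop {T}.
Arguments EBot {T}.

Definition extlit_code (T : Type) (x : extlit T) : literal T + bool :=
  match x with ELit l => inl l | ETop => inr true | EBot => inr false end.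

Definition extlit_decode (T : Type) (s : literal T + bool) : extlit T :=
  match s with
  | inl l => ELit l
  | inr b => if b then ETop else EBot
  end.

Lemma extlit_codeK (T : Type) : cancel (@extlit_code T) (@extlit_decode T).
Proof. by case. Qed.

HB.instance Definition _ (T : eqType) :=
  Equality.copy (extlit T) (can_type (@extlit_codeK T)).

(* [Top] and [Bot] are complementary: N2 proves both [Iff (SNeg Top) Bot] and
   [Iff (SNeg Bot) Top]. *)
Definition ecompl (T : Type) (x : extlit T) : extlit T :=
  match x with ELit l => ELit (compl l) | ETop => EBot | EBot => ETop end.

Definition ext_map (T U : Type) (f : T -> U) (x : extlit T) : extlit U :=
  match x with ELit l => ELit (lit_map f l) | ETop => ETop | EBot => EBot end.

Definition ext_formula (T : Type) (x : extlit T) : formula T :=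
  match x with ELit l => lit_formula l | ETop => Top | EBot => Bot end.

Definition ext_literals (T : Type) (x : extlit T) : seq (literal T) :=
  if x is ELit l then [:: l] else [::].

(* [Rule L [:: B_1; ..; B_m] [:: B_(m+1); ..; B_n]] is
   L <- B_1, .., B_m, not B_(m+1), .., not B_n *)
Record rule (T : Type) : Type := Rule {
  head : extlit T;
  pos : seq (extlit T);
  neg : seq (extlit T)
}.

Definition rule_code (T : Type) (r : rule T) :
    extlit T * seq (extlit T) * seq (extlit T) :=
  (head r, pos r, neg r).

Definition rule_decode (T : Type)
    (t : extlit T * seq (extlit T) * seq (extlit T)) : rule T :=
  Rule t.1.1 t.1.2 t.2.

Lemma rule_codeK (T : Type) : cancel (@rule_code T) (@rule_decode T).
Proof. by case. Qed.

HB.instance Definition _ (T : eqType) :=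
  Equality.copy (rule T) (can_type (@rule_codeK T)).

(* A finite set of rules, given by an enumeration; the order and the
   multiplicity of the rules are irrelevant to everything below. *)
Definition program (T : Type) : Type := seq (rule T).

Definition conjuncts (T : Type) (r : rule T) : seq (formula T) :=
  map (@ext_formula T) (pos r) ++ [seq Not (ext_formula x) | x <- neg r].

Definition body (T : Type) (r : rule T) : formula T := conj (conjuncts r).

Definition rule_formula (T : Type) (r : rule T) : formula T :=
  Imp (body r) (ext_formula (head r)).

Definition is_constraint (T : Type) (r : rule T) : bool :=
  if head r is EBot then true else false.

Definition rule_literals (T : Type) (r : rule T) : seq (literal T) :=
  flatten (map (@ext_literals T) (head r :: pos r ++ neg r)).

Definition literals (T : Type) (P : program T) : seq (literal T) :=
  flatten (map (@rule_literals T) P).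

Definition atoms (T : Type) (P : program T) : seq T :=
  map (@atom_of T) (literals P).

(* The extended alphabet: the atoms themselves, two copies of each atom, and a
   rejection atom for each rule of the first and of the second program. *)
Inductive uatom (T : Type) : Type :=
| Orig of T
| Copy1 of T
| Copy2 of T
| Rej1 of rule T
| Rej2 of rule T.

Definition uatom_code (T : Type) (u : uatom T) :
    T + T + T + rule T + rule T :=
  match u with
  | Orig a => inl (inl (inl (inl a)))
  | Copy1 a => inl (inl (inl (inr a)))
  | Copy2 a => inl (inl (inr a))
  | Rej1 r => inl (inr r)
  | Rej2 r => inr r
  end.

Definition uatom_decode (T : Type) (s : T + T + T + rule T + rule T) :
    uatom T :=
  match s with
  | inl (inl (inl (inl a))) => Orig a
  | inl (inl (inl (inr a))) => Copy1 a
  | inl (inl (inr a)) => Copy2 a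
  | inl (inr r) => Rej1 r
  | inr r => Rej2 r
  end.

Lemma uatom_codeK (T : Type) : cancel (@uatom_code T) (@uatom_decode T).
Proof. by case. Qed.

HB.instance Definition _ (T : eqType) :=
  Equality.copy (uatom T) (can_type (@uatom_codeK T)).

Definition rej (T : Type) (r : rule T) : extlit (uatom T) :=
  ELit (Pos (Rej1 r)).

Definition rule_map (T U : Type) (f : T -> U) (r : rule T) : rule U :=
  Rule (ext_map f (head r)) (map (ext_map f) (pos r)) (map (ext_map f) (neg r)).

Definition oplus1 (T : Type) (P1 P2 : program T) : program (uatom T) :=
  let pos0 r := map (ext_map (@Orig T)) (pos r) in
  let neg0 r := map (ext_map (@Orig T)) (neg r) in
  let copy0 := ext_map (@Orig T) in
  let copy1 := ext_map (@Copy1 T) in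
  let copy2 := ext_map (@Copy2 T) in
  [seq rule_map (@Orig T) r | r <- P1 ++ P2 & is_constraint r]
  ++ [seq Rule (copy1 (head r)) (pos0 r) (rcons (neg0 r) (rej r))
     | r <- P1 & ~~ is_constraint r]
  ++ [seq Rule (rej r) (rcons (pos0 r) (ecompl (copy2 (head r)))) (neg0 r)
     | r <- P1 & ~~ is_constraint r]
  ++ [seq Rule (copy2 (head r)) (pos0 r) (neg0 r)
     | r <- P2 & ~~ is_constraint r]
  ++ [seq Rule (copy1 (ELit l)) [:: copy2 (ELit l)] [::]
     | l <- literals (P1 ++ P2)]
  ++ [seq Rule (copy0 (ELit l)) [:: copy1 (ELit l)] [::]
     | l <- literals (P1 ++ P2)].

Definition update_atoms (T : Type) (P1 P2 : program T) : seq (uatom T) :=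
  map (@Orig T) (atoms (P1 ++ P2))
  ++ map (@Copy1 T) (atoms (P1 ++ P2))
  ++ map (@Copy2 T) (atoms (P1 ++ P2))
  ++ map (@Rej1 T) P1
  ++ map (@Rej2 T) P2.

(* The intersection with the literals over the atoms of the two programs is
   read back, along [Orig], as a set of literals over the initial alphabet. *)
Definition update_answer_sets (T : eqType) (P1 P2 : program T) :
    set (set (literal T)) :=
  [set lit_map (@Orig T) @^-1` S' `&` Lit (atoms (P1 ++ P2))
  | S' in answer_sets (update_atoms P1 P2)
            (map (@rule_formula (uatom T)) (oplus1 P1 P2))].

Definition bodies (T : eqType) (L : extlit T) (P : program T) :
    seq (formula T) :=
  undup [seq body r | r <- P & head r == L].

Definition sup (T : eqType) (L : extlit T) (P : program T) : formula T :=
  if ~~ has (fun r => head r == L) P then Bot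
  else if Top \in bodies L P then Top
  else disj (bodies L P).

(* The result is a set of formulas rather than an extended logic program,
   since [sup] may be a disjunction of conjunctions. *)
Definition oplus3 (T : eqType) (P1 P2 : program T) : seq (formula T) :=
  [seq rule_formula r | r <- P1 ++ P2 & is_constraint r]
  ++ [seq Imp (conj (rcons (conjuncts r) (Not (sup (ecompl (head r)) P2))))
              (ext_formula (head r))
     | r <- P1 & ~~ is_constraint r]
  ++ [seq rule_formula r | r <- P2].

(* Main.v *)
(* N2 is sound and complete for here-and-there models with strong negation, so
   answer sets are equilibrium models: [M] is an answer set iff [(M, M)] is a
   model and no [(H, M)] with [H] properly included in [M] is one. An update
   answer set [U] is determined by its trace [S] on the original literals: since
   every literal of [U] is supported, [U] contains [L_1] iff [L] is in [S],
   [L_2] iff some rule of [P2] with head [L] has its body true in [S], and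
   [rej(r)] iff the body of [r] and [sup(~L, P2)] are true in [S], where [L] is
   the head of [r]. This expansion turns models of the second program into
   models of the first, and closed subsets of it restrict back, so minimality
   transfers both ways. *)
From mathcomp Require Import all_boot.
From mathcomp Require Import boolp classical_sets.
Require Import Defs.

Set Implicit Arguments.
Unset Strict Implicit.
Unset Printing Implicit Defensive.

Local Open Scope classical_set_scope.

(** * Here-and-there semantics with strong negation, and soundness *)

(* [force H T true F] says that the here-and-there interpretation [(H, T)]
   verifies [F] at the world [H], [force H T false F] that it falsifies [F]. *)
Fixpoint force (A : Type) (H T : set (literal A)) (b : bool) (F : formula A) :
    Prop :=
  match F with
  | Atom a => H (if b then Pos a else Neg a)
  | Bot => if b then False else True
  | And F G => if b then force H T b F /\ force H T b G
               else force H T b F \/ force H T b G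
  | Or F G => if b then force H T b F \/ force H T b G
              else force H T b F /\ force H T b G
  | Imp F G =>
      if b then (force H T true F -> force H T true G) /\
                (force T T true F -> force T T true G)
      else force H T true F /\ force H T false G
  | SNeg F => force H T (~~ b) F
  end.

Section HereAndThere.

Variables (A : Type) (H T : set (literal A)).
Hypotheses (sHT : H `<=` T) (Tc : consistent_literals T).

Lemma force_persistent b F : force H T b F -> force T T b F.
Proof.
elim: F b => [a||F IF G IG|F IF G IG|F IF G IG|F IF] [] //=; try exact: sHT.
- by move=> [/IF ? /IG ?].
- by move=> [/IF ?|/IG ?]; [left|right].
- by move=> [/IF ?|/IG ?]; [left|right].
- by move=> [/IF ? /IG ?].
- by move=> [_ ?].
- by move=> [/IF ? /IG ?].
- exact: IF.
- exact: IF.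
Qed.

(** Persistence makes each axiom a propositional tautology in the values of its subformulas at the
    two worlds. Consistency of [T] serves [ax_snegAtom]; [ax_N2] is decided by excluded middle on
    these values. *)
Lemma N2_axiom_sound F : N2_axiom F -> force H T true F.
Proof.
have p G : force H T true G -> force T T true G by apply: force_persistent.
case=> [G K|G K L|G K|G K|G K|G K|G K|G K L|G|G K|G K|G K|G|G|a|G K] /=.
- by have := p G; tauto.
- by have := p G; have := p K; have := p (Imp G K);
    have := p (Imp G (Imp K L)) => /=; tauto.
- by have := p G; tauto.
- by tauto.
- by tauto.
- by tauto.
- by tauto.
- by have := p (Imp G L); have := p (Imp K L) => /=; tauto.
- by tauto.
- by tauto.
- by tauto.
- by tauto.
- by tauto.
- by tauto.
- have c : T (Pos a) -> T (Neg a) -> False by move=> ? ?; apply: (Tc (l := Pos a)).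
  by have := @sHT (Pos a); have := @sHT (Neg a); tauto.
- have := p G; have := p K.
  by have := EM (force T T true G); have := EM (force T T true K);
    have := EM (force H T true G); have := EM (force H T true K); tauto.
Qed.

Lemma N2_sound (X : set (formula A)) F :
  (forall G, X G -> force H T true G) -> N2 X F -> force H T true F.
Proof.
move=> XP; elim=> {F} [F /XP//|F /N2_axiom_sound//|F G _ [+ _] _ IF].
exact.
Qed.

End HereAndThere.

(** * Derived rules of N2 *)

Section Derivations.

Variable A : Type.
Implicit Types (X Y : set (formula A)) (F G K : formula A).

Lemma N2_weak X Y F : X `<=` Y -> N2 X F -> N2 Y F.
Proof.
move=> XY; elim=> {F} [F /XY|F|F G _ IF _ IG]; [exact: N2_hyp|exact: N2_ax|].
exact: N2_mp IF IG.
Qed.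

Lemma N2_K X F G : N2 X F -> N2 X (Imp G F).
Proof. by apply: N2_mp; apply/N2_ax/ax_K. Qed.

Lemma N2_deduction X F G : N2 (X `|` [set F]) G -> N2 X (Imp F G).
Proof.
elim=> {G} [G [XG|->]|G axG|K G _ IK _ IG].
- exact/N2_K/N2_hyp.
- apply: (N2_mp (F := Imp F (Imp F F))); last exact/N2_ax/ax_K.
  by apply: (N2_mp (F := Imp F (Imp (Imp F F) F)));
    apply: N2_ax; [exact: ax_S|exact: ax_K].
- exact/N2_K/N2_ax.
- by apply: N2_mp IG; apply: N2_mp IK; apply/N2_ax/ax_S.
Qed.

Lemma N2_last X F : N2 (X `|` [set F]) F.
Proof. by apply: N2_hyp; right. Qed.

Lemma N2_add X F G : N2 X G -> N2 (X `|` [set F]) G.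
Proof. by apply: N2_weak; left. Qed.

Lemma N2_trans X F G K : N2 X (Imp F G) -> N2 X (Imp G K) -> N2 X (Imp F K).
Proof.
move=> FG GK; apply/N2_deduction/(N2_mp (N2_add _ GK)).
exact/(N2_mp (N2_add _ FG))/N2_last.
Qed.

Lemma N2_exfalso X F : N2 X Bot -> N2 X F.
Proof. by apply: N2_mp; apply/N2_ax/ax_botE. Qed.

Lemma N2_orE X F G K :
  N2 X (Imp F K) -> N2 X (Imp G K) -> N2 X (Imp (Or F G) K).
Proof. by move=> ? /(N2_mp _); apply; apply: N2_mp; first exact/N2_ax/ax_orE. Qed.

Lemma N2_nn X F : N2 X F -> N2 X (Not (Not F)).
Proof.
by move=> XF; apply/N2_deduction/(N2_mp (N2_last _ _))/N2_add.
Qed.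

Lemma N2_nn_mp X F G :
  N2 X (Not (Not (Imp F G))) -> N2 X (Not (Not F)) -> N2 X (Not (Not G)).
Proof.
move=> nnFG nnF; apply/N2_deduction/(N2_mp (N2_add _ nnFG))/N2_deduction.
by apply: N2_mp (N2_add _ (N2_add _ nnF)) _;
  apply: N2_trans (N2_last _ _) (N2_add _ (N2_last _ _)).
Qed.

(** This comes from the instance of [ax_N2] at [F] and [Not F]: its first disjunct gives
    [Not (Not F)], and its second, [Imp F (Not F)], contracts to [Not F]. *)
Lemma N2_wem X F : N2 X (Or (Not F) (Not (Not F))).
Proof.
apply: (N2_mp (F := Or F (Or (Imp F (Not F)) (Not (Not F))))); last first.
  exact/N2_ax/ax_N2.
apply: N2_orE; last apply: N2_orE.
- apply/N2_deduction/(N2_mp (N2_ax _ (ax_orIr _ _)))/N2_nn/N2_last.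
- apply: N2_trans (N2_ax _ (ax_orIl _ _)).
  do 2 apply: N2_deduction.
  apply: N2_mp (N2_last _ _).
  by apply: N2_mp (N2_last _ _); apply/N2_add/N2_last.
- exact/N2_ax/ax_orIr.
Qed.

End Derivations.

(** * Prime theories and the truth lemma *)

Section PrimeTheory.

Variable A : Type.
Implicit Types (D E : formula A -> Prop) (F G : formula A).

Record prime_theory D : Prop := PrimeTheory {
  th_ax : forall F, N2_axiom F -> D F;
  th_mp : forall F G, D (Imp F G) -> D F -> D G;
  th_prime : forall F G, D (Or F G) -> D F \/ D G;
  th_cons : ~ D Bot
}.

Definition strong_sign (b : bool) F := if b then F else SNeg F.

Section OneTheory.

Variable D : formula A -> Prop.
Hypothesis thD : prime_theory D.

Let ax1 F G : N2_axiom (Imp F G) -> D F -> D G.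
Proof. by move=> /(th_ax thD) /(th_mp thD). Qed.

Lemma th_and F G : D (And F G) <-> D F /\ D G.
Proof.
split=> [DFG|[DF /(th_mp thD _)]]; last by apply; apply: ax1 DF; apply: ax_andI.
by split; apply: ax1 DFG; [exact: ax_andEl|exact: ax_andEr].
Qed.

Lemma th_or F G : D (Or F G) <-> D F \/ D G.
Proof.
split=> [/(th_prime thD)//|[]]; apply: ax1; [exact: ax_orIl|exact: ax_orIr].
Qed.

Lemma th_iff F G : N2_axiom (Iff F G) -> (D F <-> D G).
Proof.
by move=> /(th_ax thD) /th_and[FG GF]; split; apply: (th_mp thD).
Qed.

(** No axiom speaks of [SNeg Bot] directly: it appears on comparing the values that [ax_snegImp] and
    [ax_snegNot] give to the strong negation of [Not Top]. *)
Lemma th_snegBot : D (SNeg Bot).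
Proof.
suff /th_and[] : D (And (Imp Bot Bot) (SNeg Bot)) by [].
apply/(th_iff (ax_snegImp _ _))/(th_iff (ax_snegNot _)).
exact/(th_ax thD)/ax_botE.
Qed.

End OneTheory.

(** The index [false] stands for the world there, [true] for the world here. Nelson's axioms make
    membership of [SNeg F] obey the falsity clauses of [force], so the induction treats truth and
    falsity together. *)
Lemma prime_theory_truth (D : bool -> formula A -> Prop) :
  (forall w, prime_theory (D w)) ->
  (forall w F G, D w (Imp F G) <->
     (D w F -> D w G) /\ (D false F -> D false G)) ->
  let V w := [set l | D w (lit_formula l)] in
  forall F w b, force (V w) (V false) b F <-> D w (strong_sign b F).
Proof.
move=> thD impD V; elim=> [a||F IF G IG|F IF G IG|F IF G IG|F IF] w b /=.
- by case: b.
- case: b => /=; first by split=> // /(th_cons (thD w)).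
  by split=> // _; apply: th_snegBot.
- case: b => /=; first by rewrite th_and// IF IG.
  by rewrite (th_iff (thD w) (ax_snegAnd _ _)) th_or// (IF w false) (IG w false).
- case: b => /=; first by rewrite th_or// IF IG.
  by rewrite (th_iff (thD w) (ax_snegOr _ _)) th_and// (IF w false) (IG w false).
- case: b => /=; first by rewrite impD !IF !IG.
  by rewrite (th_iff (thD w) (ax_snegImp _ _)) th_and// (IF w true) (IG w false).
- case: b => /=; first by rewrite (IF w false).
  by rewrite -(th_iff (thD w) (ax_snegSneg _)) (IF w true).
Qed.

End PrimeTheory.

(** * Strong completeness by prime extension *)

Section Completeness.

Variable A : Type.
Implicit Types (X Y : set (formula A)) (F G K : formula A).

(** A derivation uses finitely many hypotheses, so one member of the chain contains all those it
    takes from the union. Keeping [X] apart lets the left disjunct cover the empty chain. *)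
Lemma N2_compact X (C : set (set (formula A))) F :
  total_on C subset -> N2 (X `|` \bigcup_(Y in C) Y) F ->
  N2 X F \/ exists2 Y, C Y & N2 (X `|` Y) F.
Proof.
move=> totC; elim=> {F} [F [XF|[Y CY YF]]|F axF|F G _ IF _ IG].
- by left; apply: N2_hyp.
- by right; exists Y => //; apply: N2_hyp; right.
- by left; apply: N2_ax.
case: IF => [FG|[Y CY FG]]; case: IG => [XF|[Z CZ XF]].
- by left; apply: N2_mp FG XF.
- right; exists Z => //; apply: N2_mp XF.
  by apply: N2_weak FG; left.
- right; exists Y => //; apply: (N2_mp FG).
  by apply: N2_weak XF; left.
- right; case: (totC Y Z CY CZ) => sYZ; [exists Z|exists Y] => //.
    by apply: N2_mp XF; apply: N2_weak FG; apply: setUS.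
  by apply: (N2_mp FG); apply: N2_weak XF; apply: setUS.
Qed.

(** Lindenbaum's argument: Zorn's lemma yields a maximal [Y] such that [X] with [Y] does not derive
    [F]. By maximality every underivable [G] has [Imp G F] derivable, so a derivable disjunction of
    two underivable formulas would yield [F]. *)
Lemma N2_prime_extension X F :
  ~ N2 X F -> exists2 Y, X `<=` Y & ~ N2 Y F /\ prime_theory (N2 Y).
Proof.
move=> nXF; have chain C : C `<=` (fun Y => ~ N2 (X `|` Y) F) ->
    total_on C subset -> ~ N2 (X `|` \bigcup_(Y in C) Y) F.
  by move=> CP totC /(N2_compact totC)[//|[Y /CP]].
have [Y [nYF maxY]] := Zorn_bigcup chain.
have{maxY} maxY G : ~ N2 (X `|` Y) G -> N2 (X `|` Y) (Imp G F).
  move=> nG; apply: N2_deduction; apply: contrapT; rewrite -setUA.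
  move/maxY; apply; split; first by left.
  by move=> /(_ G (or_intror erefl)) YG; apply: nG; apply: N2_hyp; right.
exists (X `|` Y); [by left|split=> //; split=> [G|G K|G K GK|]].
- exact: N2_ax.
- exact: N2_mp.
- apply: contrapT => /not_orP[/maxY GF /maxY KF]; apply: nYF.
  exact: N2_mp (N2_orE GF KF) GK.
- by move=> /(N2_exfalso F).
Qed.

Section PrimeModel.

Variable X : set (formula A).
Hypothesis thX : prime_theory (N2 X).

(** The world there is read off the same theory as the formulas whose double negation is derivable.
    Weak excluded middle makes it prime. *)
Let there F := N2 X (Not (Not F)).

Let wem F : N2 X (Not F) \/ there F.
Proof. exact/(th_prime thX)/N2_wem. Qed.

Let absurdX F : N2 X (Not F) -> ~ there F.
Proof. by move=> nF nnF; apply: (th_cons thX); apply: N2_mp nnF nF. Qed.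

Let imp_of_not F G : N2 X (Not F) -> N2 X (Imp F G).
Proof. by move=> /N2_trans; apply; apply/N2_ax/ax_botE. Qed.

Lemma there_prime : prime_theory there.
Proof.
split=> [F axF|F G|F G nnFG|nnBot].
- exact/N2_nn/N2_ax.
- exact: N2_nn_mp.
- case: (wem F) => [nF|]; [right|by left].
  case: (wem G) => // nG.
  by have := @absurdX (Or F G) (N2_orE nF nG).
- by apply: absurdX nnBot; apply/N2_ax/ax_botE.
Qed.

Let world (w : bool) := if w then N2 X else there.

Lemma world_imp w F G :
  world w (Imp F G) <-> (world w F -> world w G) /\ (there F -> there G).
Proof.
have thI : there (Imp F G) -> there F -> there G by apply: (th_mp there_prime).
split; case: w => /=.
- move=> FG; split; first exact: (th_mp thX).
  by apply: thI; apply: N2_nn.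
- by move=> /thI.
(* The axiom gives [F], [Imp F G] or [Not G]. In the last case [F] cannot hold there, since [G]
   would too, and weak excluded middle leaves [Not F]. *)
- move=> [FG nnFG]; have := @N2_ax _ X _ (ax_N2 F G).
  move=> /(th_prime thX)[/FG /N2_K//|/(th_prime thX)[//|nG]].
  by case: (wem F) => [/imp_of_not//|/nnFG /(absurdX nG)].
- move=> [FG _]; case: (wem F) => [nF|/FG]; first exact/N2_nn/imp_of_not.
  by apply: N2_nn_mp; apply/N2_nn/N2_ax/ax_K.
Qed.

Lemma prime_theory_model : exists H T : set (literal A),
  [/\ H `<=` T, consistent_literals T &
      forall F, force H T true F <-> N2 X F].
Proof.
have thW w : prime_theory (world w) by case: w => //; apply: there_prime.
exists [set l | world true (lit_formula l)], [set l | world false (lit_formula l)].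
split=> [l /= /N2_nn//|l|F]; last first.
  exact: (prime_theory_truth thW world_imp F true true).
suff c a : ~ (there (Atom a) /\ there (SNeg (Atom a))).
  by case: l => a /= [? ?]; apply: (c a).
move=> [Ta Tn]; apply: (th_cons there_prime); apply: (th_mp there_prime) Ta.
by apply: (th_mp there_prime) Tn; apply/(th_ax there_prime)/ax_snegAtom.
Qed.

End PrimeModel.

Lemma N2_complete X F : ~ N2 X F -> exists H T : set (literal A),
  [/\ H `<=` T, consistent_literals T,
      forall G, X G -> force H T true G & ~ force H T true F].
Proof.
move=> /N2_prime_extension[Y XY [nYF /prime_theory_model[H [T [sHT Tc HTP]]]]].
exists H, T; split=> // [G /XY YG|/HTP//].
exact/HTP/N2_hyp.
Qed.

End Completeness.

(** * Answer sets as equilibrium models *)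

Section Equilibrium.

Variable A : eqType.
Implicit Types (H M T : set (literal A)) (B : seq A).

Fixpoint over B (F : formula A) : bool :=
  match F with
  | Atom a => a \in B
  | Bot => true
  | And F G | Or F G | Imp F G => over B F && over B G
  | SNeg F => over B F
  end.

(** Models produced by completeness may contain literals outside [B]; formulas over [B] do not see
    them. *)
Lemma force_restrict B H T b F : over B F ->
  force H T b F = force (H `&` Lit B) (T `&` Lit B) b F.
Proof.
elim: F H b => [a||F IF G IG|F IF G IG|F IF G IG|F IF] H b //=; last exact: IF.
- move=> aB; apply: propext; split=> [Ha|[]//]; split=> //.
  by case: b {Ha}.
- by case/andP=> oF oG; rewrite -IF// -IG.
- by case/andP=> oF oG; rewrite -IF// -IG.
- case/andP=> oF oG; case: b; last by rewrite -IF// -IG.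
  by rewrite -!IF// -!IG.
Qed.

Lemma force_lit H T l : force H T true (lit_formula l) <-> H l.
Proof. by case: l. Qed.

Definition models H T (Th : seq (formula A)) : Prop :=
  forall F, F \in Th -> force H T true F.

(** With [H] inside [T], a negated or doubly negated literal depends on [T] alone. The formulas
    added to [Th] thus fix [T] on [Lit B] and ask nothing more of [H]. *)
Lemma force_completion B Th H T M : H `<=` T -> M `<=` Lit B ->
  (forall F, completion B Th M F -> force H T true F) <->
  models H T Th /\ T `&` Lit B = M.
Proof.
move=> sHT sM; split=> [cP|[HTP TM] F [[/HTP//|[l [lB nMl] <-]]|[l Ml <-]]].
- split=> [F FTh|]; first by apply: cP; left; left.
  apply/seteqP; split=> [l [Tl lB]|l Ml].
    apply: contrapT => nMl.
    suff /= [_] : force H T true (Not (lit_formula l)).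
      by rewrite force_lit.
    by apply: cP; left; right; exists l.
  split; last exact: sM.
  have /= [_] : force H T true (Not (Not (lit_formula l))).
    by apply: cP; right; exists l.
  by rewrite force_lit => nn; apply: contrapT => nTl; apply: nn; split.
- by rewrite /= !force_lit; split=> [/sHT Tl|Tl]; apply: nMl; rewrite -TM.
- have Tl : T l by move: Ml; rewrite -TM => -[].
  rewrite /= !force_lit; split=> -[_]; exact.
Qed.

Lemma models_restrict B Th H T : all (over B) Th ->
  models H T Th <-> models (H `&` Lit B) (T `&` Lit B) Th.
Proof.
move=> /allP ThB; split=> HT F FTh.
  by rewrite -force_restrict; [exact: HT|exact: ThB].
by rewrite (force_restrict _ _ _ (ThB _ FTh)); apply: HT.
Qed.

(** By completeness a consistent completion has a model, which persists to [(M, M)]; derivability of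
    all literals of [M] then amounts to minimality of [M] as the world here. *)
Lemma answer_setsP B Th M : all (over B) Th ->
  answer_sets B Th M <->
  [/\ M `<=` Lit B, consistent_literals M, models M M Th &
      forall H, H `<=` M -> models H M Th -> M `<=` H].
Proof.
move=> ThB; split=> -[sM cM].
- move=> cons der; split=> // [|H sHM HM l /der /N2_sound].
    case/N2_complete: cons => H [T [sHT Tc HTP _]].
    have [HT <-] := (force_completion Th sHT sM).1 HTP.
    by apply: (models_restrict _ _ ThB).1 => F /HT; apply: (force_persistent sHT).
  rewrite -[H l](force_lit H M); apply=> //.
  by apply/force_completion => //; split=> //; apply: setIidl.
- move=> MM minM; have MMc : forall F, completion B Th M F -> force M M true F.
    by apply/force_completion => //; split=> //; apply: setIidl.
  split=> // [/(N2_sound (@subset_refl _ M) cM)|l Ml]; first exact.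
  (* A countermodel to the derivation of [l], cut down to [Lit B], has [M] there and a world here
     that misses [l], against minimality. *)
  apply: contrapT => /N2_complete[H [T [sHT Tc HTP]]].
  have [HT TM] := (force_completion Th sHT sM).1 HTP.
  rewrite force_lit; apply.
  suff : (H `&` Lit B) l by case.
  apply: minM => //; rewrite -TM; first exact: setSI.
  exact: (models_restrict _ _ ThB).1.
Qed.

End Equilibrium.

(** * Logic programs in here-and-there models *)

Section Programs.

Variable A : eqType.
Implicit Types (H M T : set (literal A)) (B : seq A) (P : program A).
Implicit Types (x : extlit A) (r : rule A) (s : seq (formula A)).

Definition ext_holds H x : Prop :=
  match x with ELit l => H l | ETop => True | EBot => False end.

(** Negated entries are tested at [T] only, as in the reduct: for [H] inside [T], failure at [T]
    entails failure at [H]. *)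
Definition body_holds H T (p n : seq (extlit A)) : Prop :=
  (forall x, x \in p -> ext_holds H x) /\ (forall x, x \in n -> ~ ext_holds T x).

Definition applicable H T r : Prop := body_holds H T (pos r) (neg r).

Definition closed H T P : Prop :=
  forall r, r \in P -> applicable H T r -> ext_holds H (head r).

(** The semantic counterpart of [sup], which also expresses that a literal of an answer set is
    supported by a rule. *)
Definition derives P H T x : Prop :=
  exists2 r, r \in P & head r = x /\ applicable H T r.

Lemma force_ext H T x : force H T true (ext_formula x) <-> ext_holds H x.
Proof. by case: x => [l||] //; apply: force_lit. Qed.

Lemma force_conj H T s :
  force H T true (conj s) <-> models H T s.
Proof.
elim: s => [|F [|G s] IH] /=; first by split=> // _ [].
  by split=> [FP G|]; [rewrite inE => /eqP->|apply; rewrite inE].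
rewrite -/(conj (G :: s)) IH; split=> [[FP sP] K|sP].
  by rewrite inE => /predU1P[->|/sP].
by split=> [|K Ks]; apply: sP; rewrite inE ?eqxx// Ks orbT.
Qed.

Lemma force_disj H T s :
  force H T true (disj s) <-> exists2 F, F \in s & force H T true F.
Proof.
elim: s => [|F [|G s] IH] /=; first by split=> // -[].
  by split=> [FP|[G]]; [exists F => //; rewrite inE|rewrite inE => /eqP->].
rewrite -/(disj (G :: s)) IH; split=> [[FP|[K Ks KP]]|[K]].
- by exists F; rewrite ?inE ?eqxx.
- by exists K; rewrite // inE Ks orbT.
- by rewrite inE => /predU1P[->|Ks]; [left|right; exists K].
Qed.

Section Forcing.

Variables H T : set (literal A).
Hypothesis sHT : H `<=` T.

Lemma ext_holds_persistent x : ext_holds H x -> ext_holds T x.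
Proof. by case: x => //= l; apply: sHT. Qed.

Lemma models_conjuncts r : models H T (conjuncts r) <-> applicable H T r.
Proof.
split=> [cP|[pP nP] F].
  split=> x xr.
    by apply/(force_ext H T)/cP; rewrite mem_cat map_f.
  have /= [_] : force H T true (Not (ext_formula x)).
    by apply: cP; rewrite mem_cat (map_f (fun x => Not (ext_formula x))) ?orbT.
  by rewrite force_ext.
rewrite mem_cat => /orP[/mapP[x /pP xH ->]|/mapP[x /nP xT ->]].
  exact/force_ext.
by rewrite /= !force_ext; split=> // /ext_holds_persistent.
Qed.

Lemma force_body r : force H T true (body r) <-> applicable H T r.
Proof. by rewrite force_conj models_conjuncts. Qed.

End Forcing.

Lemma applicable_persistent H T r :
  H `<=` T -> applicable H T r -> applicable T T r.
Proof.
by move=> sHT [pP nP]; split=> // x /pP; apply: ext_holds_persistent.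
Qed.

Lemma derives_persistent P H T x :
  H `<=` T -> derives P H T x -> derives P T T x.
Proof.
by move=> sHT [r rP [rx /(applicable_persistent sHT) rT]]; exists r.
Qed.

Lemma force_rule H T r : H `<=` T ->
  force H T true (rule_formula r) <->
  (applicable H T r -> ext_holds H (head r)) /\
  (applicable T T r -> ext_holds T (head r)).
Proof. by move=> sHT; rewrite /= !force_ext !force_body. Qed.

Lemma models_program H T P : H `<=` T ->
  models H T (map (@rule_formula A) P) <-> closed H T P /\ closed T T P.
Proof.
move=> sHT; split=> [HP|[HP TP] _ /mapP[r rP ->]].
  by split=> r rP; have /(force_rule _ sHT)[] := HP _ (map_f _ rP).
by apply/force_rule => //; split; [exact: HP|exact: TP].
Qed.

Lemma force_sup H T x P : H `<=` T ->
  force H T true (sup x P) <-> derives P H T x.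
Proof.
move=> sHT; rewrite /sup.
have bodiesP F : F \in bodies x P <-> exists2 r, r \in P & head r = x /\ F = body r.
  rewrite mem_undup; split=> [/mapP[r + ->]|[r rP [<- ->]]].
    by rewrite mem_filter => /andP[/eqP <- rP]; exists r.
  by rewrite map_f// mem_filter eqxx.
case: ifPn => [/hasPn nP|_].
  by split=> // -[r /nP /eqP nx []].
(* A rule with body [Top] is applicable everywhere, matching the value [Top] of [sup]. *)
case: ifPn => [/bodiesP[r rP [rx rT]]|_]; last rewrite force_disj.
  split=> // _; exists r => //; split=> //.
  by apply/(force_body sHT); rewrite -rT /=.
split=> [[_ /bodiesP[r rP [rx ->]] /(force_body sHT) rH]|[r rP [rx rH]]].
  by exists r.
by exists (body r); [apply/bodiesP; exists r|apply/force_body].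
Qed.

Definition ext_over B x := if x is ELit l then atom_of l \in B else true.

Lemma over_ext B x : over B (ext_formula x) = ext_over B x.
Proof. by case: x => [[]||]. Qed.

Lemma over_conj B s : over B (conj s) = all (over B) s.
Proof.
elim: s => [|F [|G s] IH] //; first by rewrite /= andbT.
by rewrite -[RHS]/(over B F && all (over B) (G :: s)) -IH.
Qed.

Lemma over_disj B s : over B (disj s) = all (over B) s.
Proof.
elim: s => [|F [|G s] IH] //; first by rewrite /= andbT.
by rewrite -[RHS]/(over B F && all (over B) (G :: s)) -IH.
Qed.

Lemma over_conjuncts B r :
  all (over B) (conjuncts r) = all (ext_over B) (pos r ++ neg r).
Proof.
rewrite !all_cat !all_map; congr (_ && _); apply: eq_all => x /=.
  exact: over_ext.
by rewrite over_ext andbT.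
Qed.

Lemma over_rule B r :
  over B (rule_formula r) = all (ext_over B) (head r :: pos r ++ neg r).
Proof. by rewrite /= over_conj over_conjuncts over_ext andbC. Qed.

Lemma over_sup B x P :
  all (fun r => all (ext_over B) (pos r ++ neg r)) P -> over B (sup x P).
Proof.
move=> /allP PB; rewrite /sup; case: ifP => // _; case: ifP => // _.
rewrite over_disj; apply/allP => F; rewrite mem_undup => /mapP[r].
by rewrite mem_filter => /andP[_ /PB rB] ->; rewrite /body over_conj over_conjuncts.
Qed.

Lemma mem_literals P r l :
  r \in P -> ELit l \in head r :: pos r ++ neg r -> l \in literals P.
Proof.
move=> rP lr; apply/flatten_mapP; exists r => //.
by apply/flatten_mapP; exists (ELit l); rewrite // inE.
Qed.

Lemma over_atoms P r : r \in P ->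
  all (ext_over (atoms P)) (head r :: pos r ++ neg r).
Proof.
move=> rP; apply/allP => -[l||] // lr.
by rewrite /= map_f// (mem_literals rP).
Qed.

(* Removing an unsupported literal [l] from the world "here" keeps every rule
   satisfied, against the minimality of [M]. *)
Lemma answer_set_supported B P M l :
  all (over B) (map (@rule_formula A) P) ->
  answer_sets B (map (@rule_formula A) P) M -> M l -> derives P M M (ELit l).
Proof.
move=> PB /(answer_setsP _ PB)[_ _ MP minM] Ml; apply: contrapT => nl.
have sM : M `\ l `<=` M by move=> ? [].
suff /(minM _ sM)/(_ l Ml)[_] : models (M `\ l) M (map (@rule_formula A) P) by apply.
have [_ MM] := (models_program P (@subset_refl _ M)).1 MP.
apply/models_program => //; split=> // r rP /(applicable_persistent sM) rM.
have := MM r rP rM; case rl': (head r) => [l'||] //= Ml'; split=> // ll'.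
by apply: nl; exists r => //; rewrite rl' ll'.
Qed.

End Programs.

(** * Rule bodies under renaming of atoms and addition of an entry *)

Lemma models_cat (A : eqType) (H T : set (literal A)) s t :
  models H T (s ++ t) <-> models H T s /\ models H T t.
Proof.
split=> [HP|[sP tP] F]; last by rewrite mem_cat => /orP[/sP|/tP].
by split=> F Fs; apply: HP; rewrite mem_cat Fs ?orbT.
Qed.

Lemma ext_holds_map (A B : eqType) (f : A -> B) (H : set (literal B)) x :
  ext_holds H (ext_map f x) = ext_holds (lit_map f @^-1` H) x.
Proof. by case: x. Qed.

Lemma body_holds_map (A B : eqType) (f : A -> B) (H T : set (literal B)) p n :
  body_holds H T (map (ext_map f) p) (map (ext_map f) n) <->
  body_holds (lit_map f @^-1` H) (lit_map f @^-1` T) p n.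
Proof.
split=> -[pP nP]; split.
- by move=> x /(map_f (ext_map f))/pP; rewrite ext_holds_map.
- by move=> x /(map_f (ext_map f))/nP; rewrite ext_holds_map.
- by move=> _ /mapP[x /pP xH ->]; rewrite ext_holds_map.
- by move=> _ /mapP[x /nP xT ->]; rewrite ext_holds_map.
Qed.

Lemma body_holds_rcons_pos (A : eqType) (H T : set (literal A)) p n x :
  body_holds H T (rcons p x) n <-> body_holds H T p n /\ ext_holds H x.
Proof.
split=> [[pP nP]|[[pP nP] xH]]; last first.
  by split=> // y; rewrite mem_rcons inE => /predU1P[->|/pP].
split; last by apply: pP; rewrite mem_rcons mem_head.
by split=> // y yp; apply: pP; rewrite mem_rcons inE yp orbT.
Qed.

Lemma body_holds_rcons_neg (A : eqType) (H T : set (literal A)) p n x :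
  body_holds H T p (rcons n x) <-> body_holds H T p n /\ ~ ext_holds T x.
Proof.
split=> [[pP nP]|[[pP nP] xT]]; last first.
  by split=> // y; rewrite mem_rcons inE => /predU1P[->|/nP].
split; last by apply: nP; rewrite mem_rcons mem_head.
by split=> // y yn; apply: nP; rewrite mem_rcons inE yn orbT.
Qed.

Lemma body_holds_pos1 (A : eqType) (H T : set (literal A)) x :
  body_holds H T [:: x] [::] <-> ext_holds H x.
Proof.
split=> [[pP _]|xH]; first by apply: pP; rewrite mem_head.
by split=> // y; rewrite inE => /eqP->.
Qed.

Lemma ecompl_map (A B : Type) (f : A -> B) x :
  ecompl (ext_map f x) = ext_map f (ecompl x).
Proof. by case: x => [[]||]. Qed.

Lemma constraint_head (A : Type) (r : rule A) : is_constraint r -> head r = EBot.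
Proof. by rewrite /is_constraint; case: (head r). Qed.

(** * Semantic reading of the two update programs *)

Section Updates.

Variables (A : eqType) (P1 P2 : program A).
Implicit Types (S : set (literal A)) (U V : set (literal (uatom A))).
Implicit Types (r : rule A) (l : literal A) (x : extlit A).

Local Notation P := (P1 ++ P2).
Local Notation orig U := (lit_map (@Orig A) @^-1` U).
Local Notation copy1 U := (lit_map (@Copy1 A) @^-1` U).
Local Notation copy2 U := (lit_map (@Copy2 A) @^-1` U).

(** A view of membership in [oplus1 P1 P2] with one constructor per group of rules, for reasoning by
    cases. *)
Variant oplus1_rule : rule (uatom A) -> Prop :=
| Oplus1_constraint r of r \in P & is_constraint r :
    oplus1_rule (rule_map (@Orig A) r)
| Oplus1_inherit r of r \in P1 & ~~ is_constraint r :
    oplus1_rule (Rule (ext_map (@Copy1 A) (head r))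
      (map (ext_map (@Orig A)) (pos r))
      (rcons (map (ext_map (@Orig A)) (neg r)) (rej r)))
| Oplus1_reject r of r \in P1 & ~~ is_constraint r :
    oplus1_rule (Rule (rej r)
      (rcons (map (ext_map (@Orig A)) (pos r))
         (ecompl (ext_map (@Copy2 A) (head r))))
      (map (ext_map (@Orig A)) (neg r)))
| Oplus1_update r of r \in P2 & ~~ is_constraint r :
    oplus1_rule (Rule (ext_map (@Copy2 A) (head r))
      (map (ext_map (@Orig A)) (pos r)) (map (ext_map (@Orig A)) (neg r)))
| Oplus1_copy1 l of l \in literals P :
    oplus1_rule (Rule (ELit (lit_map (@Copy1 A) l))
      [:: ELit (lit_map (@Copy2 A) l)] [::])
| Oplus1_orig l of l \in literals P :
    oplus1_rule (Rule (ELit (lit_map (@Orig A) l))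
      [:: ELit (lit_map (@Copy1 A) l)] [::]).

Lemma oplus1P (u : rule (uatom A)) : u \in oplus1 P1 P2 <-> oplus1_rule u.
Proof.
rewrite /oplus1 !mem_cat; split.
  do 5?[case/orP]; case/mapP=> r; rewrite ?mem_filter.
  - by case/andP=> rc rP ->; constructor.
  - by case/andP=> rc rP ->; constructor.
  - by case/andP=> rc rP ->; constructor.
  - by case/andP=> rc rP ->; constructor.
  - by move=> rP ->; constructor.
  - by move=> rP ->; constructor.
case=> r rP => [rc|rc|rc|rc||].
- by apply/orP; left; apply/mapP; exists r; rewrite // mem_filter rc.
- by apply/orP; right; apply/orP; left; apply/mapP; exists r;
    rewrite // mem_filter rc.
- by do 2!(apply/orP; right); apply/orP; left; apply/mapP; exists r;
    rewrite // mem_filter rc.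
- by do 3!(apply/orP; right); apply/orP; left; apply/mapP; exists r;
    rewrite // mem_filter rc.
- by do 4!(apply/orP; right); apply/orP; left; apply/mapP; exists r.
- by do 5!(apply/orP; right); apply/mapP; exists r.
Qed.

(** Closure under [oplus1 P1 P2], pulled back along the embeddings of atoms so that bodies speak of
    original literals; [U] is the world here, [V] the world there. *)
Definition closed1 U V : Prop := [/\
  forall r, r \in P -> is_constraint r -> ~ applicable (orig U) (orig V) r,
  forall r, r \in P1 -> ~~ is_constraint r ->
    applicable (orig U) (orig V) r -> ~ V (Pos (Rej1 r)) ->
    ext_holds (copy1 U) (head r),
  forall r, r \in P1 -> ~~ is_constraint r ->
    applicable (orig U) (orig V) r -> ext_holds (copy2 U) (ecompl (head r)) ->
    U (Pos (Rej1 r)),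
  forall r, r \in P2 -> ~~ is_constraint r ->
    applicable (orig U) (orig V) r -> ext_holds (copy2 U) (head r) &
  forall l, l \in literals P ->
    (copy2 U l -> copy1 U l) /\ (copy1 U l -> orig U l)].

Lemma closed_oplus1 U V : closed U V (oplus1 P1 P2) <-> closed1 U V.
Proof.
split=> [cU|[c1 c2 c3 c4 c5] u /oplus1P].
- split.
  + move=> r rP rc /body_holds_map rU; have /oplus1P := Oplus1_constraint rP rc.
    by move=> /cU /(_ rU); rewrite /= ext_holds_map constraint_head.
  + move=> r rP rc /body_holds_map rU nrej; have /oplus1P := Oplus1_inherit rP rc.
    move=> /cU; rewrite /= ext_holds_map; apply.
    exact/body_holds_rcons_neg.
  + move=> r rP rc /body_holds_map rU r2; have /oplus1P := Oplus1_reject rP rc.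
    move=> /cU; apply.
    by apply/body_holds_rcons_pos; rewrite ecompl_map ext_holds_map.
  + move=> r rP rc /body_holds_map rU; have /oplus1P := Oplus1_update rP rc.
    by move=> /cU; rewrite /= ext_holds_map; apply.
  + move=> l lP; split=> Ul.
      have /oplus1P := Oplus1_copy1 lP; move=> /cU; apply.
      exact/body_holds_pos1.
    have /oplus1P := Oplus1_orig lP; move=> /cU; apply.
    exact/body_holds_pos1.
- case=> [r rP rc|r rP rc|r rP rc|r rP rc|l lP|l lP].
  + by move=> /body_holds_map /c1; case.
  + move=> /body_holds_rcons_neg[/body_holds_map rU nrej] /=.
    by rewrite ext_holds_map; apply: c2.
  + move=> /body_holds_rcons_pos[/body_holds_map rU].
    by rewrite ecompl_map ext_holds_map; apply: c3.
  + by move=> /body_holds_map rU /=; rewrite ext_holds_map; apply: c4.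
  + by move=> /body_holds_pos1 /(c5 l lP).1.
  + by move=> /body_holds_pos1 /(c5 l lP).2.
Qed.

Lemma models_oplus1 U V : U `<=` V ->
  models U V (map (@rule_formula (uatom A)) (oplus1 P1 P2)) <->
  closed1 U V /\ closed1 V V.
Proof. by move=> sUV; rewrite models_program// !closed_oplus1. Qed.

(** The support condition mentions only [T]: it is negated, and by persistence its failure at [T]
    entails failure at [S]. *)
Definition closed3 S T : Prop := [/\
  forall r, r \in P -> is_constraint r -> ~ applicable S T r,
  forall r, r \in P1 -> ~~ is_constraint r -> applicable S T r ->
    ~ derives P2 T T (ecompl (head r)) -> ext_holds S (head r) &
  forall r, r \in P2 -> ~~ is_constraint r -> applicable S T r ->
    ext_holds S (head r)].

Lemma models_oplus3 S T : S `<=` T ->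
  models S T (oplus3 P1 P2) <-> closed3 S T /\ closed3 T T.
Proof.
move=> sST.
have forceP1 r :
  force S T true (Imp (conj (rcons (conjuncts r) (Not (sup (ecompl (head r)) P2))))
                    (ext_formula (head r))) <->
  (applicable S T r -> ~ derives P2 T T (ecompl (head r)) ->
     ext_holds S (head r)) /\
  (applicable T T r -> ~ derives P2 T T (ecompl (head r)) ->
     ext_holds T (head r)).
  have bodyP H : H `<=` T ->
      force H T true (conj (rcons (conjuncts r) (Not (sup (ecompl (head r)) P2))))
      <-> applicable H T r /\ ~ derives P2 T T (ecompl (head r)).
    move=> sHT; rewrite force_conj -(models_conjuncts sHT).
    split=> [HP|[rP nP] F].
      split=> [F Fr|]; first by apply: HP; rewrite mem_rcons inE Fr orbT.
      have /= [_] : force H T true (Not (sup (ecompl (head r)) P2)).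
        by apply: HP; rewrite mem_rcons mem_head.
      by rewrite force_sup.
    rewrite mem_rcons inE => /predU1P[->|/rP//] /=.
    by rewrite !force_sup//; split=> // /(derives_persistent sHT).
  by rewrite /= !force_ext !bodyP//; tauto.
have mapP Q p (f : rule A -> formula A) :
    models S T [seq f r | r <- Q & p r] <->
    forall r, r \in Q -> p r -> force S T true (f r).
  split=> [QP r rQ rp|QP _ /mapP[r + ->]].
    by apply: QP; rewrite map_f// mem_filter rp.
  by rewrite mem_filter => /andP[rp rQ]; apply: QP.
rewrite /oplus3 !models_cat !mapP models_program//.
split=> [[cP [oldP [nS nT]]]|[[c1 c2 c3] [t1 t2 t3]]].
- have cons r : r \in P -> is_constraint r ->
      ~ applicable S T r /\ ~ applicable T T r.
    move=> rP rc; have /(force_rule _ sST) := cP r rP rc.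
    by rewrite constraint_head.
  split; split=> r rP rc.
  + by case: (cons r rP rc).
  + exact: (proj1 ((forceP1 r).1 (oldP r rP rc))).
  + exact: nS.
  + by case: (cons r rP rc).
  + exact: (proj2 ((forceP1 r).1 (oldP r rP rc))).
  + exact: nT.
- split=> [r rP rc|]; last split=> [r rP rc|].
  + apply/force_rule => //; split=> rS; first by case: (c1 r rP rc).
    by case: (t1 r rP rc).
  + by apply/forceP1; split; [exact: c2|exact: t2].
  (* The last group of [oplus3] holds all rules of [P2], whereas [closed3] keeps constraints
     apart. *)
  + split=> r rP rS; have [rc|rc] := boolP (is_constraint r).
    * by case: (c1 r _ rc); rewrite // mem_cat rP orbT.
    * exact: c3.
    * by case: (t1 r _ rc); rewrite // mem_cat rP orbT.
    * exact: t3.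
Qed.

(** * Alphabets of the two update programs *)

Lemma over_update x : ext_over (atoms P) x ->
  [/\ ext_over (update_atoms P1 P2) (ext_map (@Orig A) x),
      ext_over (update_atoms P1 P2) (ext_map (@Copy1 A) x) &
      ext_over (update_atoms P1 P2) (ext_map (@Copy2 A) x)].
Proof.
by case: x => [[a|a]||] //= aP; rewrite /update_atoms !mem_cat !map_f ?orbT.
Qed.

Lemma over_update_orig (s : seq (extlit A)) : all (ext_over (atoms P)) s ->
  all (ext_over (update_atoms P1 P2)) (map (ext_map (@Orig A)) s).
Proof. by rewrite all_map; apply: sub_all => x /over_update[]. Qed.

Lemma over_rule_parts r : r \in P ->
  [/\ ext_over (atoms P) (head r), all (ext_over (atoms P)) (pos r) &
      all (ext_over (atoms P)) (neg r)].
Proof. by move=> /over_atoms; rewrite /= all_cat => /and3P. Qed.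

Lemma over_oplus1 :
  all (over (update_atoms P1 P2)) (map (@rule_formula (uatom A)) (oplus1 P1 P2)).
Proof.
have P1P r : r \in P1 -> r \in P by rewrite mem_cat => ->.
have P2P r : r \in P2 -> r \in P by rewrite mem_cat orbC => ->.
have rejB r : r \in P1 -> Rej1 r \in update_atoms P1 P2.
  by move=> rP; rewrite /update_atoms !mem_cat (map_f (@Rej1 A)) ?orbT.
have ecomplB x : ext_over (atoms P) x -> ext_over (atoms P) (ecompl x).
  by case: x => [[]||].
have litB l : l \in literals P -> ext_over (atoms P) (ELit l).
  by move=> lP; rewrite /= map_f.
apply/allP => _ /mapP[u /oplus1P + ->]; rewrite over_rule.
case=> [r rP _|r rP _|r rP _|r rP _|l /litB|l /litB] /=;
  rewrite ?all_cat ?all_rcons.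
- by have [/over_update[-> _ _] /over_update_orig-> /over_update_orig->] :=
    over_rule_parts rP.
- have [/over_update[_ -> _] /over_update_orig-> /over_update_orig->] :=
    over_rule_parts (P1P r rP).
  by rewrite /= rejB.
- have [/ecomplB/over_update[_ _ +] /over_update_orig-> /over_update_orig->] :=
    over_rule_parts (P1P r rP).
  by rewrite ecompl_map => ->; rewrite /= rejB.
- by have [/over_update[_ _ ->] /over_update_orig-> /over_update_orig->] :=
    over_rule_parts (P2P r rP).
- by move=> lB; have /over_update[_ /= -> ->] := lB : ext_over _ (ELit l).
- by move=> lB; have /over_update[/= -> ->] := lB : ext_over _ (ELit l).
Qed.

Lemma over_oplus3 : all (over (atoms P)) (oplus3 P1 P2).
Proof.
have overP r : r \in P -> over (atoms P) (rule_formula r).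
  by move=> /over_atoms; rewrite over_rule.
have P1P r : r \in P1 -> r \in P by rewrite mem_cat => ->.
have P2P r : r \in P2 -> r \in P by rewrite mem_cat orbC => ->.
apply/allP => F; rewrite !mem_cat => /or3P[]/mapP[r].
- by rewrite mem_filter => /andP[_ /overP] + ->.
- rewrite mem_filter => /andP[_ /P1P/over_rule_parts[hB pB nB]] -> /=.
  rewrite over_ext hB over_conj all_rcons over_conjuncts all_cat pB nB /= !andbT.
  apply: over_sup; apply/allP => r' /P2P/over_rule_parts[_ pB' nB'].
  by rewrite all_cat pB' nB'.
- by move=> /P2P/overP + ->.
Qed.

(** * Expansion to the update alphabet and restriction back *)

(** Taking [S = T] gives the candidate answer set; a smaller [S] gives the worlds here that test
    minimality. Strongly negated rejection atoms and all literals on [Rej2] head no rule and are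
    left out. *)
Definition expand S T : set (literal (uatom A)) := fun u =>
  match u with
  | Pos (Orig a) | Pos (Copy1 a) => S (Pos a)
  | Neg (Orig a) | Neg (Copy1 a) => S (Neg a)
  | Pos (Copy2 a) => derives P2 S T (ELit (Pos a))
  | Neg (Copy2 a) => derives P2 S T (ELit (Neg a))
  | Pos (Rej1 r) => [/\ r \in P1, ~~ is_constraint r, applicable S T r &
                        derives P2 S T (ecompl (head r))]
  | _ => False
  end.

Lemma orig_expand S T : orig (expand S T) = S.
Proof. by apply/seteqP; split=> -[]. Qed.

Lemma copy1_expand S T : copy1 (expand S T) = S.
Proof. by apply/seteqP; split=> -[]. Qed.

Lemma copy2_expand S T l : copy2 (expand S T) l = derives P2 S T (ELit l).
Proof. by case: l. Qed.

Lemma expand_mono S T : S `<=` T -> expand S T `<=` expand T T.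
Proof.
move=> sST [[a|a|a|r|r]|[a|a|a|r|r]] //=; try exact: sST;
  try exact: derives_persistent.
move=> [? ? /(applicable_persistent sST)? /(derives_persistent sST)?].
by split.
Qed.

Lemma closed3_derives S T x :
  closed3 S T -> derives P2 S T x -> ext_holds S x.
Proof.
move=> [c1 _ c3] [r rP [<- rS]].
have [rc|rc] := boolP (is_constraint r); last exact: c3.
by case: (c1 r _ rc); rewrite // mem_cat rP orbT.
Qed.

Lemma closed1_derives U V x : closed1 U V ->
  derives P2 (orig U) (orig V) x -> ext_holds (copy2 U) x.
Proof.
move=> [c1 _ _ c4 _] [r rP [<- rS]].
have [rc|rc] := boolP (is_constraint r); last exact: c4.
by case: (c1 r _ rc); rewrite // mem_cat rP orbT.
Qed.

Lemma head_literals r l : r \in P -> head r = ELit l -> l \in literals P.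
Proof. by move=> rP rl; apply: (mem_literals rP); rewrite -rl mem_head. Qed.

(** An applicable rule of [P1] that is not rejected at [T] has a complement unsupported at [T], so
    [closed3] yields its head. Literals derived by [P2] lie in [S], which settles the copy rules. *)
Lemma closed1_expand S T : S `<=` T -> closed3 S T ->
  closed1 (expand S T) (expand T T).
Proof.
move=> sST cS; have [c1 c2 c3] := cS; split; rewrite ?orig_expand ?copy1_expand.
- exact: c1.
- move=> r rP rc rS nrej; apply: c2 => // rT.
  by apply: nrej; split=> //; apply: applicable_persistent rS.
- move=> r rP rc rS r2; split=> //; move: r2 rc; rewrite /is_constraint.
  by case: (head r) => [l||] //; rewrite -[ecompl _]/(ELit _) -copy2_expand.
- move=> r rP rc rS; case rx: (head r) rc => [l||] // rc; last first.
    by move: rc; rewrite /is_constraint rx.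
  suff : derives P2 S T (ELit l) by rewrite -copy2_expand.
  by exists r.
- move=> l _; rewrite copy2_expand; split=> //.
  exact: (closed3_derives cS).
Qed.

Lemma closed1_copy1 U V r l : closed1 U V -> r \in P -> head r = ELit l ->
  (copy2 U l -> copy1 U l) /\ (copy1 U l -> orig U l).
Proof. by move=> [_ _ _ _ c5] rP /(head_literals rP)/c5. Qed.

(* [copy1 U] need not equal [orig U] in a non-minimal closed set, hence the
   intersection. *)
Lemma closed3_restrict S U : closed1 U (expand S S) ->
  closed3 (orig U `&` copy1 U) S.
Proof.
move=> cU; have [c1 c2 c3 c4 c5] := cU.
have app r : applicable (orig U `&` copy1 U) S r ->
    applicable (orig U) (orig (expand S S)) r.
  move=> [pP nP]; rewrite orig_expand; split=> // x /pP.
  by case: x => //= l [].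
have headU r : r \in P -> ext_holds (copy1 U) (head r) ->
    ext_holds (orig U `&` copy1 U) (head r).
  move=> rP; case rl: (head r) => [l||] //= Ul; split=> //.
  exact: (closed1_copy1 cU rP rl).2.
split=> r rP rc /app rU; first exact: (c1 r).
  move=> nd; apply: headU; first by rewrite mem_cat rP.
  (* [Rej1 r] in [expand S S] would bring a derivation of the complement of the head from [P2],
     against [nd]. *)
  by apply: c2 => //= -[].
have rPP : r \in P by rewrite mem_cat rP orbT.
apply: headU => //; have := c4 r rP rc rU; case rl: (head r) => [l||] //=.
exact: (closed1_copy1 cU rPP rl).1.
Qed.

(** * From answer sets of [oplus3] to answer sets of [oplus1] *)

Lemma lit_consistent (B : Type) (M : set (literal B)) :
  (forall a, M (Pos a) -> M (Neg a) -> False) -> consistent_literals M.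
Proof. by move=> c [a|a] [] => [|/[swap]]; apply: c. Qed.

Lemma expand_answer_set S : answer_sets (atoms P) (oplus3 P1 P2) S ->
  answer_sets (update_atoms P1 P2)
    (map (@rule_formula (uatom A)) (oplus1 P1 P2)) (expand S S).
Proof.
move=> /(answer_setsP _ over_oplus3)[sS cS + minS].
move=> /(models_oplus3 (@subset_refl _ S))[S3 _].
apply/(answer_setsP _ over_oplus1).
have S1 : closed1 (expand S S) (expand S S) by apply: closed1_expand.
have derS l : derives P2 S S (ELit l) -> S l by apply: closed3_derives S3.
split.
- have upd a : a \in atoms P -> [/\ Orig a \in update_atoms P1 P2,
      Copy1 a \in update_atoms P1 P2 & Copy2 a \in update_atoms P1 P2].
    exact: (@over_update (ELit (Pos a))).
  case=> [[a|a|a|r|r]|[a|a|a|r|r]] //=; rewrite /Lit /=.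
  + by move=> /sS/upd[].
  + by move=> /sS/upd[].
  + by move=> /derS/sS/upd[].
  + by move=> [rP _ _ _]; rewrite /update_atoms !mem_cat (map_f (@Rej1 A)) ?orbT.
  + by move=> /sS/upd[].
  + by move=> /sS/upd[].
  + by move=> /derS/sS/upd[].
- apply: lit_consistent => -[a|a|a|r|r] //= Sa Sn.
  + exact: (cS (Pos a)).
  + exact: (cS (Pos a)).
  + by apply: (cS (Pos a)); split; apply: derS.
- exact/models_oplus1.
move=> U sU /(models_oplus1 sU)[U1 _].
(* Minimality of [S] is applied to the restriction of [U], so [U] contains the original and the
   first copy of every literal of [S]. *)
have sSU : S `<=` orig U `&` copy1 U.
  have sUS : orig U `&` copy1 U `<=` S.
    by move=> l [Ul _]; rewrite -(orig_expand S S); apply: sU.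
  apply: minS => //; apply/(models_oplus3 sUS); split=> //.
  exact: closed3_restrict.
have origU : orig U = S.
  apply/seteqP; split=> [l /sU|l /sSU[]//].
  by rewrite -[X in X -> _]/(orig (expand S S) l) orig_expand.
(* Closure forces the rest of the expansion into [U]: the second copies derived by [P2], then the
   rejection atoms they trigger. *)
have [c1 c2 c3 c4 c5] := U1.
have derU x : derives P2 S S x -> ext_holds (copy2 U) x.
  by move=> Sx; apply: (closed1_derives U1); rewrite origU orig_expand.
case=> [[a|a|a|r|r]|[a|a|a|r|r]] //=.
- by move=> /sSU[].
- by move=> /sSU[].
- by move=> /derU.
- move=> [rP rc rS /derU r2]; apply: c3 => //; by rewrite origU orig_expand.
- by move=> /sSU[].
- by move=> /sSU[].
- by move=> /derU.
Qed.

(** * From answer sets of [oplus1] to answer sets of [oplus3] *)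

(** Inversion on the rules with head [u]. For a first copy only the occurrence of the literal in the
    programs is kept, as this is what makes the rule [L <- L_1] available. *)
Lemma oplus1_support U V u : derives (oplus1 P1 P2) U V (ELit u) ->
  match u with
  | Pos (Orig a) => copy1 U (Pos a)
  | Neg (Orig a) => copy1 U (Neg a)
  | Pos (Copy1 a) => Pos a \in literals P
  | Neg (Copy1 a) => Neg a \in literals P
  | Pos (Copy2 a) => derives P2 (orig U) (orig V) (ELit (Pos a))
  | Neg (Copy2 a) => derives P2 (orig U) (orig V) (ELit (Neg a))
  | Pos (Rej1 r) => [/\ r \in P1, ~~ is_constraint r,
      applicable (orig U) (orig V) r & ext_holds (copy2 U) (ecompl (head r))]
  | _ => False
  end.
Proof.
move=> [w /oplus1P + [+ +]]; case=> [r rP rc|r rP rc|r rP rc|r rP rc|l lP|l lP] /=.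
- by rewrite constraint_head.
- case rl: (head r) => [[a|a]||] //= [<-] _;
    by apply: (head_literals _ rl); rewrite mem_cat rP.
- move=> [<-] /body_holds_rcons_pos[/body_holds_map rU].
  by rewrite ecompl_map ext_holds_map.
- by case rl: (head r) => [[a|a]||] //= [<-] /body_holds_map rU; exists r.
- by case: l lP => a aP [<-].
- by case: l lP => a aP [<-] /body_holds_pos1.
Qed.

Section UpdateAnswerSet.

Variable U : set (literal (uatom A)).
Hypothesis ansU : answer_sets (update_atoms P1 P2)
  (map (@rule_formula (uatom A)) (oplus1 P1 P2)) U.

Let supU u Uu := oplus1_support (answer_set_supported over_oplus1 ansU (l := u) Uu).

Let U1 : closed1 U U.
Proof.
have /(answer_setsP _ over_oplus1)[_ _ + _] := ansU.
by move=> /(models_oplus1 (@subset_refl _ U))[].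
Qed.

(** Support bounds [U] from above, closure bounds it from below, and the two bounds meet in the
    expansion of the original part. *)
Lemma answer_set_expand : U = expand (orig U) (orig U).
Proof.
have [c1 c2 c3 c4 c5] := U1.
have up1 l : copy1 U l -> orig U l.
  move=> Ul; apply: (c5 l _).2 => //.
  by case: l Ul => a /supU.
have down1 l : orig U l -> copy1 U l by case: l => a /supU.
have derU x : derives P2 (orig U) (orig U) x -> ext_holds (copy2 U) x.
  exact: closed1_derives U1.
apply/seteqP; split=> [u Uu|].
  have := supU Uu; case: u Uu => -[a|a|a|r|r] //= Uu.
  + by move=> _; apply: (up1 (Pos a)).
  + move=> [rP rc rU r2]; split=> //; case rx: (head r) r2 rc => [[a|a]||] //=.
    * by move=> /supU.
    * by move=> /supU.
    * by rewrite /is_constraint rx.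
  + by move=> _; apply: (up1 (Neg a)).
case=> [[a|a|a|r|r]|[a|a|a|r|r]] //=.
- exact: (down1 (Pos a)).
- exact: derU.
- by move=> [rP rc rU /derU]; apply: c3.
- exact: (down1 (Neg a)).
- exact: derU.
Qed.

Lemma orig_answer_set : answer_sets (atoms P) (oplus3 P1 P2) (orig U).
Proof.
have /(answer_setsP _ over_oplus1)[sU cU _ minU] := ansU.
have origB : orig U `<=` Lit (atoms P).
  have upd a : Orig a \in update_atoms P1 P2 -> a \in atoms P.
    rewrite /update_atoms !mem_cat => /orP[/mapP[b bP [->//]]|].
    by do 3?[case/orP]; case/mapP.
  by move=> [a|a] /sU /upd.
have S3 : closed3 (orig U) (orig U).
  (* With this equality the intersection in [closed3_restrict] collapses to [orig U]. *)
  have c1U : copy1 U = orig U by rewrite {1}answer_set_expand copy1_expand.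
  rewrite -[X in closed3 X]setIid -{2}c1U.
  by apply: closed3_restrict; rewrite -answer_set_expand.
apply/(answer_setsP _ over_oplus3); split=> //.
- by move=> l [Ul Un]; apply: (cU (lit_map (@Orig A) l)); case: l Ul Un.
- exact/models_oplus3.
move=> S sSU /(models_oplus3 sSU)[cS _].
(* Minimality of [U] is tested on the expansion of [S] with [orig U] there. It lies in [U] and is
   closed, so it contains [U]; reading along [Orig] puts [orig U] inside [S]. *)
have sE : expand S (orig U) `<=` U.
  by rewrite [X in _ `<=` X]answer_set_expand; apply: expand_mono.
have /(minU _ sE) UE : models (expand S (orig U)) U
    (map (@rule_formula (uatom A)) (oplus1 P1 P2)).
  apply/models_oplus1 => //; split=> //.
  rewrite [X in closed1 _ X]answer_set_expand; exact: closed1_expand.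
by move=> l Ul; rewrite -(orig_expand S (orig U)); apply: UE.
Qed.

End UpdateAnswerSet.

End Updates.

(** * Equality of the two families of answer sets *)

Theorem theorem5p3 (T : eqType) (P1 P2 : program T) :
  update_answer_sets P1 P2 = answer_sets (atoms (P1 ++ P2)) (oplus3 P1 P2).
Proof.
apply/seteqP; split=> [_ [U /orig_answer_set Uans <-]|S Sans].
  by rewrite setIidl//; case: Uans.
exists (expand P1 P2 S S); first exact: expand_answer_set.
by rewrite orig_expand setIidl//; case: Sans.
Qed.
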